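(* Assume that $Y\cap\mathbb{Z}^m$ is finite. Let $p\in[1,\infty)$, let $(\Omega,\mathcal{F},\mathbb{P})$ be an atomless probability space, and let $\rho:\mathcal{L}^p(\Omega,\mathcal{F},\mathbb{P})\to\mathbb{R}$ be convex, nondecreasing and law-invariant. Let $\mathcal{M}\subseteq\mathcal{M}(X)$ be locally uniformly $\|\cdot\|^p$-integrating and let $(x,\mu)\in X\times\mathcal{M}$ be such that the set $\{z\in\mathbb{R}^s\mid\varphi\text{ is discontinuous at }Tx+z\}$ is a $\mu$-null set. Then the restriction $\mathcal{Q}_\rho|_{X\times\mathcal{M}}$ is continuous at $(x,\mu)$ with respect to the product topology of the standard topology on $\mathbb{R}^n$ and the topology of weak convergence on $\mathcal{M}$.
   Context: Let $X\subseteq\mathbb{R}^n$ be a nonempty polyhedron, $c\in\mathbb{R}^n$, $T\in\mathbb{R}^{s\times n}$, $W\in\mathbb{R}^{s\times m}$, $q,d\in\mathbb{R}^m$, and $Y\subseteq\mathbb{R}^m$ with $Y\cap\mathbb{Z}^m\neq\emptyset$. For $t\in\mathbb{R}^s$ let $\Psi(t):=\operatorname{Argmin}_y\{d^\top y \mid Wy\le t,\ y\in Y\cap\mathbb{Z}^m\}$ and $\varphi(t):=\inf_y\{q^\top y\mid y\in\Psi(t)\}\in\mathbb{R}\cup\{\pm\infty\}$, with $\inf\emptyset=+\infty$. Let $f(x,z):=c^\top x+\varphi(Tx+z)$ for $(x,z)\in\mathbb{R}^n\times\mathbb{R}^s$, and let $\operatorname{dom}f$ be the set where $f$ is finite. $\mathcal{P}(\mathbb{R}^k)$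 denotes the Borel probability measures on $\mathbb{R}^k$, endowed with the topology of weak convergence, and $\mathcal{M}(X):=\{\mu\in\mathcal{P}(\mathbb{R}^s)\mid X\times\operatorname{supp}\mu\subseteq\operatorname{dom}f\}$. For $x\in X$, $\mu\in\mathcal{M}(X)$, let $\delta_x$ be the Dirac measure at $x$; when $Y\cap\mathbb{Z}^m$ is finite, $(\delta_x\otimes\mu)\circ f^{-1}\in\mathcal{P}(\mathbb{R})$ has bounded support, so, the space being atomless, there is $Z_{(x,\mu)}\in\mathcal{L}^p(\Omega,\mathcal{F},\mathbb{P})$ with distribution $\mathbb{P}\circ Z_{(x,\mu)}^{-1}=(\delta_x\otimes\mu)\circ f^{-1}$. Define $\mathcal{Q}_\rho:X\times\mathcal{M}(X)\to\mathbb{R}$ by $\mathcal{Q}_\rho(x,\mu):=\rho[Z_{(x,\mu)}]$; this is well defined because $\rho$ is law-invariant (i.e. $\rho[Y_1]=\rho[Y_2]$ whenever $Y_1,Y_2$ have the same distribution). $\rho$ is nondecreasing if $\rho[Y_1]\le\rho[Y_2]$ whenever $Y_1\le Y_2$ $\mathbb{P}$-a.s. A set $\mathcal{M}\subseteq\mathcal{M}_s^p:=\{\nu\in\mathcal{P}(\mathbb{R}^s)\mid\int_{\mathbb{R}^s}\|t\|^p\,\nu(\mathrm{d}t)<\infty\}$ is called locally uniformly $\|\cdot\|^p$-integrating if for every sequence $\{\mu_n\}_{n\in\mathbb{N}}\subseteq\mathcal{M}$ converging weakly to some $\mu\in\mathcal{M}$ one has $\lim_{n\to\infty}\int\|t\|^p\,\mu_n(\mathrm{d}t)=\int\|t\|^p\,\mu(\mathrm{d}t)$.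 *)

(* Defs.v *)
From HB Require Import structures.
From mathcomp Require Import all_boot all_order all_algebra.
From mathcomp Require Import all_classical all_reals all_analysis.

Set Implicit Arguments.
Unset Strict Implicit.
Unset Printing Implicit Defensive.

Import Order.TTheory GRing.Theory Num.Theory.
Import numFieldNormedType.Exports.

Local Open Scope classical_set_scope.
Local Open Scope ring_scope.

Section vectors.
Context {R : realType}.

Definition dotv k (u v : 'cV[R]_k) : R := \sum_i u i ord0 * v i ord0.

Definition enorm k (u : 'cV[R]_k) : R := Num.sqrt (\sum_i u i ord0 ^+ 2).

Definition lev k (u v : 'cV[R]_k) : Prop := forall i, u i ord0 <= v i ord0.

Definition polyhedron k (X : set 'cV[R]_k) : Prop :=
  exists l (A : 'M[R]_(l, k)) (b : 'cV[R]_l), X = [set x | lev (A *m x) b].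

Definition int_points k (Y : set 'cV[R]_k) : set 'cV[R]_k :=
  [set y | Y y /\ y \is a mxOver Num.int].

End vectors.

(* R^k with its Borel sigma-algebra; the carrier is convertible to 'cV[R]_k *)
Definition borel (R : realType) (k : nat) :=
  g_sigma_algebraType (@open 'cV[R]_k).

Section weak_convergence.
Context {R : realType} {k : nat}.

Definition bounded_continuous : set ('cV[R]_k -> R) :=
  [set g | continuous g /\ bounded_fun g].

Definition integrals (mu : probability (borel R k) R) :
    {ptws bounded_continuous -> R} :=
  fun g => \int[mu]_(t in [set: borel R k]) val g t.

(* the topology of weak convergence: the coarsest one for which
   mu |-> \int g dmu is continuous for all bounded continuous g *)
HB.instance Definition _ := Topological.copy (probability (borel R k) R)
  (initial_topology integrals).

Definition supp (mu : probability (borel R k) R) : set 'cV[R]_k :=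
  \bigcap_(F in [set F : set 'cV[R]_k | closed F /\ mu F = 1%E]) F.

Definition pmoment (p : R) (mu : probability (borel R k) R) : \bar R :=
  (\int[mu]_(t in [set: borel R k]) (enorm (t : 'cV[R]_k) `^ p)%:E)%E.

Definition locally_uniformly_integrating (p : R)
    (M : set (probability (borel R k) R)) : Prop :=
  M `<=` [set nu | (pmoment p nu < +oo)%E] /\
  forall (mu_ : nat -> probability (borel R k) R)
      (mu : probability (borel R k) R),
    (forall i, M (mu_ i)) -> M mu -> mu_ @ \oo --> mu ->
    (pmoment p (mu_ i) @[i --> \oo] --> pmoment p mu)%E.

End weak_convergence.

Section bilevel.
Context {R : realType} {n m s : nat}.
Variables (c : 'cV[R]_n) (T : 'M[R]_(s, n)) (W : 'M[R]_(s, m)).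
Variables (q d : 'cV[R]_m) (Y : set 'cV[R]_m).

Definition feasible (t : 'cV[R]_s) : set 'cV[R]_m :=
  [set y | lev (W *m y) t /\ int_points Y y].

Definition Psi (t : 'cV[R]_s) : set 'cV[R]_m :=
  [set y | feasible t y /\ forall y', feasible t y' -> dotv d y <= dotv d y'].

Definition phi (t : 'cV[R]_s) : \bar R :=
  ereal_inf [set (dotv q y)%:E | y in Psi t].

Definition objective (w : 'cV[R]_n * 'cV[R]_s) : \bar R :=
  ((dotv c w.1)%:E + phi (T *m w.1 + w.2))%E.

Definition dom_objective : set ('cV[R]_n * 'cV[R]_s) :=
  [set w | objective w \is a fin_num].

Definition admissible_measures (X : set 'cV[R]_n) :
    set (probability (borel R s) R) :=
  [set mu | X `*` supp mu `<=` dom_objective].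

(* image of the product of \d_x and mu under the extended-real objective, as a
   set function on R; the objective is almost everywhere finite when x is in X
   and mu is admissible *)
Definition objective_law (x : 'cV[R]_n) (mu : probability (borel R s) R)
    (B : set R) : \bar R :=
  (@dirac _ (borel R n) x R \x mu)%E (objective @^-1` (EFin @` B)).

End bilevel.

Section risk.
Context {R : realType} {dO : measure_display} {Omega : measurableType dO}.
Variable P : probability Omega R.

Definition atomless : Prop :=
  forall A : set Omega, measurable A -> (0 < P A)%E ->
    exists B, [/\ measurable B, B `<=` A & (0 < P B < P A)%E].

Context {p : R} {p1 : (1 <= p%:E)%E}.
Variable rho : LfunType P p1 -> R.

Definition nondecreasing_risk : Prop :=
  forall Y1 Y2 : LfunType P p1,
    {ae P, forall w, Y1 w <= Y2 w} -> rho Y1 <= rho Y2.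

(* measures are compared on measurable sets only: the values of a measure on
   other sets carry no meaning *)
Definition law_invariant : Prop :=
  forall Y1 Y2 : LfunType P p1,
    (forall B : set R, measurable B ->
      distribution P Y1 B = distribution P Y2 B) ->
    rho Y1 = rho Y2.

Context {n m s : nat}.
Variables (c : 'cV[R]_n) (T : 'M[R]_(s, n)) (W : 'M[R]_(s, m)).
Variables (q d : 'cV[R]_m) (Y : set 'cV[R]_m).

Definition has_objective_law (x : 'cV[R]_n) (mu : probability (borel R s) R) :
    set (LfunType P p1) :=
  [set Z | forall B : set R, measurable B ->
    distribution P Z B = objective_law c T W q d Y x mu B].

(* Z_(x, mu) is chosen among all random variables with the required law; the
   default value 0 is only used when there are none *)
Definition Q_risk (w : 'cV[R]_n * probability (borel R s) R) : R :=
  rho (xget 0 (has_objective_law w.1 w.2)).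

End risk.

(* Main.v *)
Require Import Defs.
From HB Require Import structures.
From mathcomp Require Import all_boot all_order all_algebra.
From mathcomp Require Import all_classical all_reals all_analysis.
From mathcomp Require Import measurable_realfun ring lra.

(** As there are finitely many integer points, the value function [phi] takes
    finitely many finite values v_i. Hence the law of the objective at (y, nu)
    is a finite sum of point masses: it charges c.y + v_i with the weight
    nu {z | phi (T y + z) = v_i}. Two facts about such laws are combined.

    The weights are lower semicontinuous at (x, mu). Where [phi] is continuous
    it is locally constant, so that, up to a mu-null set, the event defining a
    weight is the preimage of an open set by a translation; a version of the
    portmanteau inequality that is uniform over small translations
    ([portmanteau_shift]) concludes ([value_weight_lsc]). This one-sided control
    is enough, since the weights of an admissible pair sum to one
    ([sum_value_weight]).

    The risk is stable under small changes of the weights. As [rho] only depends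
    on laws, the representatives can be chosen ([Q_riskE]): given Z with the law
    at (x, mu), the absence of atoms allows to build Z' with the law at
    (x', nu) that differs from Z by the small constant c.(x' - x) outside an
    event of small probability ([sierpinski], [coupling_partition]). Both
    variables are bounded, so it remains to see that [rho] does not react to a
    bounded change on an event of small probability ([risk_continuity]). This is
    the automatic continuity of finite convex monotone functionals on L^p. If it
    failed along events of quickly decreasing probabilities, the k-th change
    would be below U / k for a single U in L^p; by convexity its effect would be
    at most (rho (Z + U) - rho Z) / k, which tends to 0. *)

Set Implicit Arguments.
Unset Strict Implicit.
Unset Printing Implicit Defensive.

Import Order.TTheory GRing.Theory Num.Theory.
Import numFieldNormedType.Exports.

Local Open Scope classical_set_scope.
Local Open Scope ring_scope.

(** * Splitting an atomless probability space *)

Section atomless_probability.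
Context {R : realType} {d : measure_display} {T : measurableType d}.
Variable P : probability T R.

(** Greedy choice: from the current member of [C] pass to a larger one that is
    within 1/(n+1) of the supremum of what can still be reached. The union of
    the resulting sequence cannot be enlarged any more. *)
Lemma exhaustion (C : set (set T)) :
  C `<=` measurable -> C !=set0 ->
  (forall F : nat -> set T, (forall i, C (F i)) -> nondecreasing_seq F ->
    C (\bigcup_i F i)) ->
  exists2 B, C B & forall B', C B' -> B `<=` B' -> (P B' <= P B)%E.
Proof.
move=> mC [B0 CB0] Cup.
pose S B := ereal_sup [set P B' | B' in [set B' | C B' /\ B `<=` B']].
have SB1 B : (S B <= 1)%E.
  by apply: ge_ereal_sup => _ [B' [/mC mB' _] <-]; exact: probability_le1.
have S_ub B B' : C B' -> B `<=` B' -> (P B' <= S B)%E.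
  by move=> CB' BB'; apply: ereal_sup_ubound; exists B'.
have next (iB : nat * {B | C B}) : exists B' : {B | C B},
    sval iB.2 `<=` sval B' /\
    (S (sval iB.2) <= P (sval B') + (iB.1.+1%:R^-1)%:E)%E.
  case: iB => i [B CB] /=.
  have SBfin : S B \is a fin_num.
    rewrite ge0_fin_numE; first exact: le_lt_trans (SB1 B) (ltry _).
    by apply: le_trans (S_ub _ _ CB _).
  have [_ [B' [CB' BB'] <-]] := @ub_ereal_sup_adherent R
    [set P B' | B' in [set B' | C B' /\ B `<=` B']] i.+1%:R^-1
    ltac:(by []) SBfin.
  rewrite lteBlDr// => h.
  by exists (exist _ B' CB'); split => //; exact/ltW.
have [f fP] := choice next.
pose F := fix F n := if n is n'.+1 then f (n', F n') else exist _ B0 CB0.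
pose G n := sval (F n).
have CG n : C (G n) by rewrite /G; case: (F n).
have Gle : nondecreasing_seq G.
  apply/nondecreasing_seqP => n; apply/subsetPset.
  by have [+ _] := fP (n, F n).
have mG n : measurable (G n) by exact/mC.
have CU := Cup _ CG Gle.
exists (\bigcup_i G i) => // B' CB' GB'.
apply/lee_addgt0Pr => e e0.
have [n ne] : exists n, n.+1%:R^-1 <= e.
  exists (Num.truncn e^-1).
  rewrite invf_ple ?posrE//.
  by apply/ltW; rewrite truncnS_gt.
have [_ /= h] := fP (n, F n).
apply: (le_trans (S_ub (G n) _ CB' _)).
  by apply: subset_trans GB'; exact: bigcup_sup.
apply: (le_trans h); apply: leeD; last by rewrite lee_fin.
apply: le_measure; rewrite ?inE//; first exact: (mG n.+1).
  exact: mC.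
exact: (@bigcup_sup _ _ n.+1).
Qed.

(** The probability of an event as a real number, in a form suited to turning
    extended-real inequalities into real ones. *)
Lemma prob_real A : measurable A -> exists2 a : R, P A = a%:E & 0 <= a <= 1.
Proof.
move=> mA; have PA1 := probability_le1 P mA.
have PAE : P A = (fine (P A))%:E by rewrite fineK//; exact: fin_num_measure.
by exists (fine (P A)) => //; rewrite -!lee_fin -PAE PA1 andbT.
Qed.

Lemma prob_setD A B : measurable A -> measurable B -> B `<=` A ->
  P (A `\` B) = (P A - P B)%E.
Proof.
move=> mA mB BA; rewrite measureD//.
  by rewrite (setIidr BA).
exact: le_lt_trans (probability_le1 P mA) (ltry 1).
Qed.

(** This and the next lemma state additivity for the set function of [P] itself;
    the library facts mention the underlying content, which is convertible to
    it but does not match it when rewriting. *)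
Lemma prob_setU A B : measurable A -> measurable B -> A `&` B = set0 ->
  P (A `|` B) = (P A + P B)%E.
Proof. exact: measureU. Qed.

Lemma prob_bigsetU (N : nat) (B : nat -> set T) (b : nat -> R) :
  (forall i, measurable (B i)) -> trivIset setT B ->
  (forall i, (i < N)%N -> P (B i) = (b i)%:E) ->
  P (\big[setU/set0]_(i < N) B i) = (\sum_(i < N) b i)%:E.
Proof.
move=> mB tB PB; rewrite -sumEFin; transitivity (\sum_(i < N) P (B i))%E.
  exact: measure_bigsetU.
by apply: eq_bigr => i _; rewrite PB.
Qed.

Lemma le_prob A B : measurable A -> measurable B -> A `<=` B -> (P A <= P B)%E.
Proof. by move=> mA mB AB; apply: le_measure; rewrite ?inE. Qed.

Hypothesis P_atomless : atomless P.

(** An event of positive probability splits in two nontrivial pieces, one of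
    which has at most half of its probability; iterating gives events of
    positive but arbitrarily small probability. *)
Lemma atomless_small A (e : R) : measurable A -> (0 < P A)%E -> 0 < e ->
  exists B, [/\ measurable B, B `<=` A & (0 < P B <= e%:E)%E].
Proof.
move=> mA PA e0.
have halving n : exists B, [/\ measurable B, B `<=` A &
    (0 < P B <= (2^-1 ^+ n)%:E)%E].
  elim: n => [|n [B [mB BA /andP[PB0 PBn]]]].
    by exists A; split => //; rewrite PA/= expr0; exact: probability_le1.
  have [B' [mB' B'B /andP[PB'0 PB'B]]] := P_atomless mB PB0.
  have [b Pb _] := prob_real mB; have [b' Pb' _] := prob_real mB'.
  have PD := prob_setD mB mB' B'B.
  move: PB0 PBn PB'0 PB'B; rewrite Pb Pb' !lee_fin !lte_fin => b0 bn b'0 b'b.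
  have [h|h] := leP b' (2^-1 ^+ n.+1).
    exists B'; split => //; first exact: subset_trans BA.
    by rewrite Pb' lte_fin b'0/= lee_fin.
  exists (B `\` B'); split; first exact: measurableD.
    by apply: subset_trans BA; exact: subDsetl.
  rewrite PD Pb Pb' -EFinB lte_fin lee_fin subr_gt0 b'b/=.
  by move: h; rewrite exprS; lra.
have [n ne] : exists n, 2^-1 ^+ n <= e.
  have : (fun n => 2^-1 ^+ n : R) @ \oo --> (0 : R).
    by apply: cvg_expr; rewrite ger0_norm ?invr_ge0// invf_lt1// ltr1n.
  move/cvgrPdist_le => /(_ e e0) [n _ /(_ n (leqnn n))].
  rewrite /= sub0r normrN => h; exists n.
  by apply: le_trans h; exact: ler_norm.
have [B [mB BA /andP[PB0 PBn]]] := halving n.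
by exists B; split => //; rewrite PB0/=; apply: (le_trans PBn); rewrite lee_fin.
Qed.

(** Sierpinski's theorem. Among the subevents of [A] of probability at most
    [a], one that is maximal for inclusion up to probability must reach [a]:
    otherwise a small event of the remainder could be added to it. *)
Lemma sierpinski A (a : R) : measurable A -> 0 <= a -> (a%:E <= P A)%E ->
  exists B, [/\ measurable B, B `<=` A & P B = a%:E].
Proof.
move=> mA a0 aA.
pose C := [set B | [/\ measurable B, B `<=` A & (P B <= a%:E)%E]].
have CC : C `<=` measurable by move=> B [].
have [||B [mB BA PBa] Bmax] := exhaustion CC.
- by exists set0; split => //; rewrite measure0 lee_fin.
- move=> F CF ndF; have mF i : measurable (F i) by have [] := CF i.
  have mU : measurable (\bigcup_i F i) by exact: bigcupT_measurable.
  split => //; first by apply: bigcup_sub => i _; have [] := CF i.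
  have PF := nondecreasing_cvg_mu (mu := P) mF mU ndF.
  rewrite -(cvg_lim _ PF)//; apply: lime_le; first exact: cvgP PF.
  by apply: nearW => i; have [] := CF i.
exists B; split => //.
have [b Pb _] := prob_real mB; have [c Pc _] := prob_real mA.
move: PBa aA; rewrite Pb Pc !lee_fin => ba ac; congr EFin.
apply/eqP; rewrite eq_le ba/= leNgt; apply/negP => {}ba.
have mD : measurable (A `\` B) by exact: measurableD.
have [||E [mE ED /andP[PE0 PEe]]] := @atomless_small (A `\` B) (a - b) mD.
- by rewrite prob_setD// Pb Pc -EFinB lte_fin; lra.
- by rewrite subr_gt0.
have [e Pe _] := prob_real mE.
have PBE : P (B `|` E) = (b + e)%:E.
  rewrite prob_setU// ?Pb ?Pe//.
  by apply/seteqP; split => // w [Bw /ED[]].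
move: PE0 PEe; rewrite Pe lte_fin lee_fin => e0 eab.
have /Bmax : C (B `|` E).
  split; first exact: measurableU.
    by rewrite subUset; split => //; apply: subset_trans ED _; exact: subDsetl.
  by rewrite PBE lee_fin; lra.
by move=> /(_ (@subsetUl _ B E)); rewrite PBE Pb lee_fin; lra.
Qed.

Lemma partition_weights (N : nat) (w : nat -> R) A :
  measurable A -> (forall i, 0 <= w i) -> ((\sum_(i < N) w i)%:E <= P A)%E ->
  exists B : nat -> set T, [/\ forall i, measurable (B i),
    forall i, B i `<=` A, trivIset setT B,
    forall i, (i < N)%N -> P (B i) = (w i)%:E &
    forall i, (N <= i)%N -> B i = set0].
Proof.
move=> mA w0; elim: N => [|N IH] sw.
  exists (fun=> set0); split => //; first by move=> i; exact: sub0set.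
  by apply/trivIsetP => *; rewrite set0I.
have [|B [mB BA tB PB B0]] := IH.
  apply: le_trans sw; rewrite lee_fin big_ord_recr/=.
  by rewrite lerDl.
pose U := \big[setU/set0]_(i < N) B i.
have mU : measurable U by exact: bigsetU_measurable.
have PU : P U = (\sum_(i < N) w i)%:E.
  exact: prob_bigsetU.
have UA : U `<=` A.
  by rewrite /U -bigcup_mkord; apply: bigcup_sub => i _; exact: BA.
have [|E [mE ED PE]] := @sierpinski (A `\` U) (w N) (measurableD mA mU) (w0 N).
  rewrite prob_setD// PU; move: sw; have [a -> _] := prob_real mA.
  by rewrite -EFinB !lee_fin big_ord_recr/=; lra.
have EB i : E `&` B i = set0.
  have [iN|/B0 ->] := ltnP i N; last by rewrite setI0.
  apply/seteqP; split => // t [/ED[_ nUt] Bit]; apply: nUt.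
  by rewrite /U -bigcup_mkord; exists i.
exists (fun i => if i == N then E else B i); split.
- by move=> i; case: ifP.
- by move=> i; case: ifP => // _; apply: subset_trans ED _; exact: subDsetl.
- apply/trivIsetP => i j _ _ ij.
  have [iN|iN] := eqVneq i N; have [jN|jN] := eqVneq j N.
  + by rewrite iN jN eqxx in ij.
  + exact: EB.
  + by rewrite setIC.
  + by move/trivIsetP : tB; exact.
- move=> i; rewrite ltnS leq_eqVlt; have [->//|iN /=] := eqVneq i N.
  exact: PB.
- by move=> i Ni; rewrite gtn_eqF// B0// ltnW.
Qed.

(** Transport of mass between two finite partitions, up to null events: keep in each
    cell the part of probability min (b i) (w i), which costs nothing, and cut
    the remaining event [D] to fill the deficits [w i - min (b i) (w i)]. The
    probability of [D] only involves the cells that lose mass, so lower bounds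
    on the new weights are enough to make it small. *)
Lemma coupling_partition (N : nat) (B : nat -> set T) (b w : nat -> R) :
  (forall i, measurable (B i)) -> trivIset setT B ->
  (forall i, (i < N)%N -> P (B i) = (b i)%:E) -> (forall i, (N <= i)%N -> B i = set0) ->
  \sum_(i < N) b i = 1 ->
  (forall i, 0 <= w i) -> \sum_(i < N) w i = 1 ->
  exists (B' : nat -> set T) (D : set T), [/\ 
    [/\ forall i, measurable (B' i), trivIset setT B',
    forall i, (i < N)%N -> P (B' i) = (w i)%:E &
    forall i, (N <= i)%N -> B' i = set0], measurable D,
    P D = (\sum_(i < N) (b i - Num.min (b i) (w i)))%:E &
    forall t, ~ D t -> exists2 i, (i < N)%N & B i t /\ B' i t].
Proof.
move=> mB tB PB B0 sb w0 sw.
pose m i := Num.min (b i) (w i).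
have exC i : exists C, [/\ measurable C, C `<=` B i &
    (i < N)%N -> P C = (m i)%:E].
  have [iN|iN] := ltnP i N; last by exists set0; split.
  have [|||C [mC CB PC]] := @sierpinski (B i) (m i); last by exists C; split.
  - exact: mB.
  - rewrite /m le_min w0 andbT -lee_fin -PB//.
  - by rewrite PB// lee_fin /m ge_min lexx.
have [C CP] := choice exC.
have mC i : measurable (C i) by have [] := CP i.
have CB i : C i `<=` B i by have [] := CP i.
have PC i : (i < N)%N -> P (C i) = (m i)%:E by have [] := CP i.
have tC : trivIset setT C.
  apply/trivIsetP => i j _ _ ij; apply/seteqP; split => // t [/CB Bi /CB Bj].
  by move/trivIsetP : tB => /(_ i j I I ij); rewrite -subset0; apply.
pose U := \big[setU/set0]_(i < N) C i.
have mU : measurable U by exact: bigsetU_measurable.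
have PU : P U = (\sum_(i < N) m i)%:E.
  exact: prob_bigsetU.
pose D := ~` U.
have mD : measurable D by exact: measurableC.
have PD : P D = (\sum_(i < N) (b i - m i))%:E.
  rewrite probability_setC// PU -EFinB; congr EFin.
  by rewrite sumrB sb.
have [||E [mE ED tE PE E0]] := @partition_weights N (fun i => w i - m i) D mD.
- by move=> i; rewrite subr_ge0 /m ge_min lexx orbT.
- by rewrite PD lee_fin !sumrB sw sb.
have CE i j : C i `&` E j = set0.
  have [iN|iN] := ltnP i N; last first.
    by have := @CB i; rewrite B0// subset0 => ->; rewrite set0I.
  apply/seteqP; split => // t [Ct /ED]; rewrite /D/=; apply.
  by rewrite /U -bigcup_mkord; exists i.
exists (fun i => C i `|` E i), D; split.
- split.
  + by move=> i; exact: measurableU.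
  + apply/trivIsetP => i j _ _ ij.
    rewrite setIUl !setIUr CE (setIC (E i)) CE.
    move/trivIsetP : tC => ->//; move/trivIsetP : tE => ->//.
    by rewrite !setU0.
  + by move=> i iN; rewrite prob_setU// PC// PE// -EFinD addrC subrK.
  + move=> i iN; rewrite E0// setU0; have := @CB i.
    by rewrite B0// subset0 => ->.
- exact: mD.
- exact: PD.
- move=> t /contrapT; rewrite /U -bigcup_mkord => -[i /= iN Ct].
  by exists i => //; split; [exact: CB|left].
Qed.

End atomless_probability.

(** * Continuity of a convex monotone risk functional *)

Section risk_continuity.
Context {R : realType} {d : measure_display} {T : measurableType d}.
Variables (P : probability T R) (p : R) (p1 : (1 <= p%:E)%E).

(** Borel-Cantelli in L^p: the function (sum_k (k+1)^p 1_(A_k))^(1/p) has an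
    integrable p-th power as soon as the probabilities of the [A k] decrease
    fast enough, and it is at least k+1 on [A k]. *)
Lemma Lfun_dominates_sets (A : nat -> set T) :
  (forall k, measurable (A k)) ->
  (forall k, ((k.+1%:R `^ p)%:E * P (A k) <= (1 / (2 ^ k.+1)%:R)%:E)%E) ->
  exists2 G : LfunType P p1, forall t, 0 <= G t &
    {ae P, forall t, forall k, A k t -> k.+1%:R <= G t}.
Proof.
move=> mA PA.
have p_gt0 : 0 < p by move: p1; rewrite lee_fin; exact: lt_le_trans.
pose h k t : \bar R := ((k.+1%:R `^ p)%:E * (\1_(A k) t)%:E)%E.
have h0 k t : (0 <= h k t)%E by rewrite /h -EFinM lee_fin mulr_ge0// powR_ge0.
have mh k : measurable_fun setT (h k).
  apply: measurable_funeM; apply/measurable_EFinP.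
  exact: measurable_indic.
pose g t := (\sum_(0 <= k <oo) h k t)%E.
have mg : measurable_fun setT g.
  exact: (@ge0_emeasurable_sum _ _ _ setT h xpredT).
have g0 t : (0 <= g t)%E by apply: nneseries_ge0.
have intg : (\int[P]_t g t <= 1%:E)%E.
  rewrite integral_nneseries//.
  apply: le_trans (epsilon_trick0 xpredT (@ler01 R)).
  apply: lee_nneseries => [k _ _|k _]; first exact: integral_ge0.
  rewrite ge0_integralZl_EFin ?powR_ge0//.
  - by rewrite integral_indic// setIT.
  - by apply/measurable_EFinP; exact: measurable_indic.
have ig : P.-integrable setT g.
  apply/integrableP; split => //; apply: le_lt_trans (ltry 1).
  by under eq_integral do rewrite gee0_abs//.
pose G t := fine (g t) `^ p^-1.
have mG : measurable_fun setT G.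
  apply: (measurableT_comp (measurable_powR _)).
  by apply: measurableT_comp mg; exact: fine_measurable.
have fG : G \in Lfun P p%:E.
  apply/andP; split; rewrite inE//= /finite_norm unlock poweR_lty//.
  apply: le_lt_trans (ltry 1); apply: le_trans intg.
  apply: ge0_le_integral => //.
  - move=> t _; exact: poweR_ge0.
  - apply/measurable_EFinP; apply: (measurableT_comp (measurable_powR _)).
    exact: measurableT_comp.
  - move=> t _ /=; rewrite ger0_norm ?powR_ge0// -powRrM mulVf ?gt_eqF//.
    rewrite powRr1 ?fine_ge0//.
    by have := g0 t; case: (g t) => //= r; rewrite leey.
exists (Lfun_Sub p1 fG); first by move=> t /=; exact: powR_ge0.
have := integrable_ae measurableT ig; apply: filterS => t /(_ I) gt k Akt /=.
have hg : (h k t <= g t)%E.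
  apply: le_trans (nneseries_lim_ge k.+1 _); last by move=> *; exact: h0.
  by rewrite big_nat_recr//= leeDr// sume_ge0.
have : k.+1%:R `^ p <= fine (g t).
  by rewrite -lee_fin fineK//; move: hg; rewrite /h indicE mem_set// mule1.
move/(ge0_ler_powR (r := p^-1)); rewrite -powRrM mulfV ?gt_eqF// powRr1//.
by apply; rewrite ?invr_ge0 ?ltW// nnegrE ?powR_ge0// fine_ge0.
Qed.

Variable rho : LfunType P p1 -> R.
Hypothesis rho_convex :
  convex_function [set: convex_lmodType (LfunType P p1)] rho.
Hypothesis rho_mono : nondecreasing_risk rho.

Lemma risk_convex (l : R) (U V : LfunType P p1) : 0 <= l <= 1 ->
  rho (l *: U + (1 - l) *: V) <= l * rho U + (1 - l) * rho V.
Proof.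
move=> /andP[l0 l1].
by have := @rho_convex (Itv01 l0 l1) U V; apply; rewrite inE.
Qed.

(** Convexity along the segment from [Z] to [Z + U] bounds the increase of
    [rho] from [Z] to [Z + l U], hence to [Z'], by l (rho (Z + U) - rho Z).
    The decrease is bounded by the same quantity because [Z] lies below the
    midpoint of [Z'] and [Z + l U]. *)
Lemma risk_domination (Z Z' U : LfunType P p1) (l : R) : 0 <= l <= 1 ->
  {ae P, forall t, `|Z' t - Z t| <= l * U t} ->
  `|rho Z' - rho Z| <= l * (rho (Z + U) - rho Z).
Proof.
move=> l01 ZZ'.
have up : rho (l *: (Z + U) + (1 - l) *: Z) <= l * rho (Z + U) + (1 - l) * rho Z.
  exact: risk_convex.
have Z'_le : rho Z' <= rho (l *: (Z + U) + (1 - l) *: Z).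
  apply: rho_mono; apply: filterS ZZ' => t /= /ler_normlP[_].
  by rewrite -[(_ + _) t]/(l * (Z t + U t) + (1 - l) * Z t); lra.
have half : 0 <= (2^-1 : R) <= 1 by apply/andP; split; lra.
have mid := risk_convex Z' (l *: (Z + U) + (1 - l) *: Z) half.
have Z_le : rho Z <= rho (2^-1 *: Z' +
    (1 - 2^-1) *: (l *: (Z + U) + (1 - l) *: Z)).
  apply: rho_mono; apply: filterS ZZ' => t /= /ler_normlP[+ _].
  rewrite -[(_ + _) t]/(2^-1 * Z' t +
    (1 - 2^-1) * (l * (Z t + U t) + (1 - l) * Z t)).
  set a := Z t; set b := Z' t; set u := U t => h.
  by lra.
by rewrite ler_norml; apply/andP; split; lra.
Qed.

(** A finite convex monotone functional on L^p is insensitive to bounded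
    changes on events of small probability. If it were sensitive to events
    [A_k] with quickly decreasing probabilities, all these changes would be
    dominated by U / (k+1) for one and the same [U = 1 + C G] in L^p, with [G]
    from [Lfun_dominates_sets], and [risk_domination] would make them
    harmless. *)
Lemma risk_continuity (Z : LfunType P p1) (C e : R) : 0 <= C -> 0 < e ->
  exists2 dl : R, 0 < dl & forall (Z' : LfunType P p1) (A : set T),
    measurable A -> (P A <= dl%:E)%E ->
    (forall t, `|Z' t - Z t| <= dl + C * \1_A t) ->
    `|rho Z' - rho Z| <= e.
Proof.
move=> C0 e0; apply: contrapT => /forall2NP no_dl.
(* The first term of the minimum takes care of the uniform part of the change,
   the second one is the rate required by Lfun_dominates_sets. *)
pose dl k : R := Num.min k.+1%:R^-1 ((1 / (2 ^ k.+1)%:R) / k.+1%:R `^ p).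
have dl0 k : 0 < dl k.
  by rewrite /dl lt_min invr_gt0 ltr0n/= !divr_gt0// ?powR_gt0// ltr0n expn_gt0.
have bad k : exists ZA : LfunType P p1 * set T, [/\ measurable ZA.2,
    (P ZA.2 <= (dl k)%:E)%E,
    forall t, `|ZA.1 t - Z t| <= dl k + C * \1_(ZA.2) t &
    e < `|rho ZA.1 - rho Z|].
  have [//|] := no_dl (dl k).
  move/existsNP => [Z' /existsNP[A /not_implyP[mA /not_implyP[PA]]]].
  move=> /not_implyP[ZZ' /negP]; rewrite -ltNge => h.
  by exists (Z', A).
have [ZA ZAP] := choice bad.
have [|k|G G0 GA] := @Lfun_dominates_sets (fun k => (ZA k).2).
- by move=> k; have [] := ZAP k.
- have [_ PA _ _] := ZAP k.
  have kp : 0 < k.+1%:R `^ p :> R by rewrite powR_gt0.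
  have : (P (ZA k).2 <= ((1 / (2 ^ k.+1)%:R) / k.+1%:R `^ p)%:E)%E.
    by apply: le_trans PA _; rewrite lee_fin ge_min lexx orbT.
  move/(lee_wpmul2l (x := (k.+1%:R `^ p)%:E)).
  rewrite lee_fin => /(_ (ltW kp)) /le_trans; apply.
  by rewrite -EFinM mulrC divfK// gt_eqF.
pose one : LfunType P p1 := Lfun_Sub p1 (Lfun_cst P 1 p).
pose U := one + C *: G.
have bound k : e < k.+1%:R^-1 * (rho (Z + U) - rho Z).
  have [mA PA ZZ' /lt_le_trans] := ZAP k; apply.
  apply: risk_domination.
    by rewrite invr_ge0 ler0n/= invf_le1// ler1n.
  apply: filterS GA => t GA; apply: (le_trans (ZZ' t)).
  rewrite -[U t]/(1 + C * G t) mulrDr mulr1 lerD//; first by rewrite ge_min lexx.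
  rewrite mulrCA ler_wpM2l// indicE; case: (boolP (t \in _)) => [/set_mem tA|_].
    by rewrite ler_pdivlMl// mulr1; exact: GA.
  by rewrite mulr_ge0// invr_ge0.
set K := rho (Z + U) - rho Z in bound.
have /(_ (Num.truncn (K / e))) := bound.
have := truncnS_gt (K / e); set N := (Num.truncn _).+1.
rewrite ltr_pdivrMr// => KN; rewrite ltr_pdivlMl// => NK.
by have := lt_trans KN NK; rewrite ltxx.
Qed.

End risk_continuity.

(** * Weak convergence on a Euclidean space *)

Section borel_sets.
Context {R : realType} {k : nat}.
Implicit Types (D G : set 'cV[R]_k) (f : 'cV[R]_k -> R).

Lemma borel_open D : open D -> measurable (D : set (borel R k)).
Proof. by move=> oD; exact: sub_sigma_algebra. Qed.

Lemma borel_closed G : closed G -> measurable (G : set (borel R k)).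
Proof.
move=> cG; rewrite -(setCK G); apply: measurableC; apply: borel_open.
exact: closed_openC.
Qed.

Lemma borel_continuous f : continuous f ->
  measurable_fun [set: borel R k] (f : borel R k -> R).
Proof.
move=> /continuousP cf; apply: (measurability _ (RGenOpens.measurableE R)).
move=> _ [_ [a [b ->] <-]]; rewrite setTI; apply: borel_open.
by apply: cf; exact: interval_open.
Qed.

Lemma lipschitz_continuous f (c : R) :
  (forall t t', `|f t - f t'| <= c * `|t - t'|) -> continuous f.
Proof.
move=> f_lip t A /nbhs_ballP[e /= e0 eA].
have c0 : 0 < `|c| + 1 by rewrite ltr_wpDl.
apply/nbhs_ballP; exists (e / (`|c| + 1)) => /=; first exact: divr_gt0.
move=> t'; rewrite -ball_normE/= ltr_pdivlMr// => tt'; apply: eA.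
rewrite -ball_normE/=; apply: le_lt_trans tt'; apply: (le_trans (f_lip _ _)).
by rewrite mulrC ler_wpM2l// (le_trans (ler_norm c))// lerDl.
Qed.

(** The function min (1, (i+1) dist (t, ~` D)), which increases to the
    indicator of an open [D]. The member 1 of the set bounds the infimum by 1
    and keeps it meaningful when the complement of [D] is empty, the infimum of
    the empty set being 0 by convention. *)
Definition lipschitz_bump D (i : nat) (t : 'cV[R]_k) : R :=
  inf ([set 1] `|` [set i.+1%:R * `|t - u| | u in ~` D]).

Section lipschitz_bump_lemmas.
Variable D : set 'cV[R]_k.
Local Notation g := (lipschitz_bump D).
Let S (i : nat) (t : 'cV[R]_k) : set R :=
  [set 1] `|` [set i.+1%:R * `|t - u| | u in ~` D].

Let S_lb i t : lbound (S i t) 0.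
Proof. by move=> _ [->//|[u _ <-]]; rewrite mulr_ge0. Qed.

Let S_neq0 i t : S i t !=set0. Proof. by exists 1; left. Qed.

Let bump_le i t v : S i t v -> g i t <= v.
Proof. by move=> Sv; apply: ge_inf => //; exists 0; exact: S_lb. Qed.

Let le_bump i t v : lbound (S i t) v -> v <= g i t.
Proof. exact: lb_le_inf. Qed.

Lemma lipschitz_bump_ge0 i t : 0 <= g i t.
Proof. by apply: le_bump; exact: S_lb. Qed.

Lemma lipschitz_bump_le1 i t : g i t <= 1.
Proof. by apply: bump_le; left. Qed.

Lemma lipschitz_bump_out i t : ~ D t -> g i t <= 0.
Proof. by move=> Dt; apply: bump_le; right; exists t; rewrite ?subrr ?normr0 ?mulr0. Qed.

Lemma lipschitz_bump_lip i t t' : g i t <= g i t' + i.+1%:R * `|t - t'|.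
Proof.
rewrite -lerBlDr; apply: le_bump => v [->|[u Du <-]]; rewrite lerBlDr.
  by rewrite (le_trans (lipschitz_bump_le1 _ _))// lerDl mulr_ge0.
apply: (@le_trans _ _ (i.+1%:R * `|t - u|)).
  by apply: bump_le; right; exists u.
by rewrite -mulrDr ler_wpM2l// [leRHS]addrC ler_distD.
Qed.

Lemma lipschitz_bump_dist i t t' : `|g i t - g i t'| <= i.+1%:R * `|t - t'|.
Proof.
rewrite ler_norml lerBlDl lipschitz_bump_lip andbT.
by rewrite lerBrDl lerBlDr distrC lipschitz_bump_lip.
Qed.

Lemma lipschitz_bump_nd i j t : (i <= j)%N -> g i t <= g j t.
Proof.
move=> ij; apply: le_bump => v [->|[u Du <-]].
  exact: lipschitz_bump_le1.
apply: (@le_trans _ _ (i.+1%:R * `|t - u|)).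
  by apply: bump_le; right; exists u.
by rewrite ler_wpM2r// ler_nat.
Qed.

Lemma lipschitz_bump_eq1 t : open D -> D t -> exists i, g i t = 1.
Proof.
move=> oD Dt; have /nbhs_ballP[e /= e0 eD] := open_nbhs_nbhs (conj oD Dt).
exists (Num.truncn e^-1); apply/eqP; rewrite eq_le lipschitz_bump_le1/=.
apply: le_bump => v [->//|[u Du <-]].
have ue : e <= `|t - u|.
  by rewrite leNgt; apply/negP => tu; apply: Du; apply: eD; rewrite -ball_normE.
have := truncnS_gt e^-1; set N := (Num.truncn _).+1 => eN.
rewrite -[leLHS](mulVf (lt0r_neq0 e0)); apply: ler_pM => //; last exact: ltW.
  by rewrite invr_ge0 ltW.
exact: ltW.
Qed.

End lipschitz_bump_lemmas.

End borel_sets.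

Section weak_topology.
Context {R : realType} {k : nat}.
Implicit Types (mu nu : probability (borel R k) R).

(** The topology on probability measures is initial for the integrals of
    bounded continuous functions, seen as a point of a product space. *)
Lemma integral_continuous (h : 'cV[R]_k -> R) : bounded_continuous h ->
  continuous (fun mu => \int[mu]_(t in [set: borel R k]) h t).
Proof.
move=> bh.
pose hb : bounded_continuous := exist _ h (mem_set bh).
have -> : (fun mu => \int[mu]_(t in [set: borel R k]) h t) =
  (fun F : {ptws bounded_continuous -> R} => F hb) \o integrals by [].
move=> mu; apply: continuous_comp.
  exact: (@initial_continuous _ _ (@integrals R k)).
exact: (@proj_continuous bounded_continuous (fun=> R) hb).
Qed.

End weak_topology.

Section norm_bounds.
Context {R : realType}.

Lemma entry_le_norm (k l : nat) (y : 'M[R]_(k, l)) i j : `|y i j| <= `|y|.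
Proof. by rewrite [leRHS]mx_normrE; exact: (le_bigmax _ (fun ij => `|y ij.1 ij.2|) (i, j)). Qed.

Lemma dotv_lip (k : nat) (u y y' : 'cV[R]_k) :
  `|dotv u y - dotv u y'| <= (\sum_i `|u i ord0|) * `|y - y'|.
Proof.
rewrite /dotv -sumrB mulr_suml; apply: (le_trans (ler_norm_sum _ _ _)).
apply: ler_sum => i _; rewrite -mulrBr normrM ler_wpM2l//.
have := entry_le_norm (y - y') i ord0; by rewrite !mxE.
Qed.

Lemma mulmx_lip (k l : nat) (A : 'M[R]_(k, l)) (y y' : 'cV[R]_l) :
  `|A *m y - A *m y'| <= (\sum_i \sum_j `|A i j|) * `|y - y'|.
Proof.
have K0 : 0 <= \sum_i \sum_j `|A i j| by apply: sumr_ge0 => i _; exact: sumr_ge0.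
rewrite -mulmxBr [leLHS]mx_normrE; apply: bigmax_le => [|[i j] _ /=].
  exact: mulr_ge0.
rewrite mxE; apply: (le_trans (ler_norm_sum _ _ _)).
apply: (@le_trans _ _ ((\sum_j `|A i j|) * `|y - y'|)).
  rewrite mulr_suml; apply: ler_sum => h _; rewrite normrM ler_wpM2l//.
  exact: entry_le_norm.
by rewrite ler_wpM2r// (bigD1 i)//= lerDl sumr_ge0// => ? _; exact: sumr_ge0.
Qed.

End norm_bounds.

Lemma open_shift (R : realType) (k : nat) (D : set 'cV[R]_k) (b : 'cV[R]_k) :
  open D -> open [set z | D (b + z)].
Proof.
move=> oD; rewrite openE => z /= Dz.
have /nbhs_ballP[r /= r0 rD] := open_nbhs_nbhs (conj oD Dz).
apply/nbhs_ballP; exists r => // z'; rewrite -ball_normE/= => zz'.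
by apply: rD; rewrite -ball_normE/= opprD addrACA subrr add0r.
Qed.

Section support.
Context {R : realType} {k : nat}.
Variable mu : probability (borel R k) R.

Lemma closed_supp : closed (supp mu).
Proof. by apply: closed_bigI => F []. Qed.

(** Every point outside the support has a null neighbourhood, which contains a
    null ball with a rational centre and radius 1/(j+1) that contains the point;
    there are only countably many of these balls. *)
Lemma supp_full : mu (supp mu) = 1%E.
Proof.
set G := supp mu; have cG : closed G := closed_supp.
pose rball (i : 'cV[rat]_k * nat) : set 'cV[R]_k :=
  ball (map_mx ratr i.1 : 'cV[R]_k) i.2.+1%:R^-1.
have mrball i : measurable (rball i : set (borel R k)).
  by apply: borel_open; apply: ball_open; rewrite invr_gt0.
pose N i : set (borel R k) := if mu (rball i) == 0%E then rball i else set0.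
have N0 i : mu.-negligible (N i).
  rewrite /N; case: ifPn => [/eqP h|_]; last exact: negligible_set0.
  by exists (rball i); split.
pose F j := if unpickle j is Some i then N i else set0.
have F0 : mu.-negligible (\bigcup_j F j).
  apply: negligible_bigcup => j; rewrite /F.
  by case: unpickle => [i|]; [exact: N0|exact: negligible_set0].
have mG : measurable (G : set (borel R k)) by exact: borel_closed.
have GF : ~` G `<=` \bigcup_j F j.
  move=> t Gt; have /existsNP[H /not_implyP[[cH muH] Ht]] := Gt.
  have oH : open (~` H) by exact: closed_openC.
  have /nbhs_ballP[e /= e0 eH] := open_nbhs_nbhs (conj oH Ht).
  have [j je] : exists j, j.+1%:R^-1 <= e / 2.
    exists (Num.truncn (e / 2)^-1).
    rewrite invf_ple ?posrE ?divr_gt0//.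
    by apply/ltW; rewrite truncnS_gt.
  have j0 : 0 < j.+1%:R^-1 :> R by rewrite invr_gt0.
  have /choice[r rP] i : exists q : rat, `|ratr q - t i ord0| < j.+1%:R^-1.
    have [|q] := @rat_in_itvoo R (t i ord0 - j.+1%:R^-1) (t i ord0 + j.+1%:R^-1).
      by rewrite ltrBlDr -addrA ltrDl addr_gt0.
    rewrite in_itv/= => /andP[h1 h2]; exists q.
    by rewrite ltr_norml ltrBrDl h1 ltrBlDl.
  pose i : 'cV[rat]_k * nat := (\col_i r i, j).
  have ti : rball i t.
    by split => // a b; rewrite !mxE ord1; exact: rP.
  have iH : rball i `<=` ~` H.
    move=> u iu; apply: eH; apply: le_ball (_ : j.+1%:R^-1 + j.+1%:R^-1 <= e) _ _.
      by rewrite (splitr e) lerD.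
    by apply: ball_triangle iu; exact: ball_sym.
  have mui : mu (rball i) = 0%E.
    apply/eqP; rewrite eq_le measure_ge0 andbT.
    have mH := borel_closed cH.
    have <- : mu (~` H) = 0%E by rewrite probability_setC// muH subee.
    by apply: le_prob => //; exact: measurableC.
  by exists (pickle i) => //; rewrite /F pickleK /N mui eqxx.
have : mu (~` G) = 0%E.
  have nG : mu.-negligible (~` G : set (borel R k)) by apply: negligibleS F0.
  by apply: measure_negligible => //; exact: measurableC.
rewrite probability_setC//; have [a -> _] := prob_real mu mG.
by rewrite -EFinB => -[] /eqP; rewrite subr_eq0 => /eqP <-.
Qed.

(** The portmanteau inequality for open sets, uniformly over small
    translations. Lipschitz bumps are used instead of arbitrary continuous
    minorants of the indicator of [D] because a translation by [a' - a] then
    changes the integrand by at most (i+1) |a' - a|, whatever the measure. *)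
Lemma portmanteau_shift (D : set 'cV[R]_k) (a : 'cV[R]_k) (e : R) :
  open D -> 0 < e ->
  exists2 dl : R, 0 < dl & nbhs mu [set nu : probability (borel R k) R |
    forall a' : 'cV[R]_k, `|a' - a| <= dl ->
    (mu [set z : 'cV[R]_k | D (a + z)%R] <=
     nu [set z : 'cV[R]_k | D (a' + z)%R] + e%:E)%E].
Proof.
move=> oD e0.
have shiftB (t t' b : 'cV[R]_k) : (b + t) - (b + t') = t - t'.
  by rewrite opprD addrACA subrr add0r.
have mshift b := borel_open (open_shift (b := b) oD).
pose g i (z : 'cV[R]_k) := lipschitz_bump D i (a + z).
have cg i : continuous (g i).
  apply: (@lipschitz_continuous _ _ _ i.+1%:R) => t t'.
  by rewrite -(shiftB t t' a); exact: lipschitz_bump_dist.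
have mg i : measurable_fun [set: borel R k] (g i : borel R k -> R).
  exact: borel_continuous.
have g0 i z : 0 <= g i z by exact: lipschitz_bump_ge0.
have g1 i z : g i z <= 1 by exact: lipschitz_bump_le1.
pose S := [set z : 'cV[R]_k | D (a + z)].
pose F i : set (borel R k) := [set z | g i z = 1].
have mF i : measurable (F i).
  by rewrite -[F i]setTI; exact: (mg i measurableT [set 1] (measurable_set1 1)).
have FS : \bigcup_i F i = S.
  apply/seteqP; split => [z [i _ Fz]|z Sz].
    apply: contrapT => /(@lipschitz_bump_out _ _ D i (a + z)) gz.
    by have : g i z <= 0 by []; rewrite (Fz : g i z = 1) ler10.
  by have [i gi] := lipschitz_bump_eq1 oD Sz; exists i.
have ndF : nondecreasing_seq F.
  move=> i j ij; apply/subsetPset => z Fz; apply/eqP.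
  by rewrite eq_le g1/= -Fz lipschitz_bump_nd.
have [sS muS _] := prob_real mu (mshift a).
have [i muF] : exists i, (mu S <= mu (F i) + (e / 3)%:E)%E.
  apply: contrapT => /forallNP noi.
  have mU : measurable (\bigcup_i F i) by exact: bigcupT_measurable.
  have cvF := nondecreasing_cvg_mu (mu := mu) mF mU ndF.
  have : (mu (\bigcup_i F i) <= (sS - e / 3)%:E)%E.
    rewrite -(cvg_lim _ cvF)//; apply: lime_le; first exact: cvgP cvF.
    apply: nearW => i /=; have /negP := noi i; rewrite -ltNge muS.
    have [f -> _] := prob_real mu (mF i).
    by rewrite -EFinD lte_fin lee_fin; lra.
  by rewrite FS muS lee_fin; lra.
pose I (nu : probability (borel R k) R) :=
  (\int[nu]_(z in [set: borel R k]) g i z)%R.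
have bcg : bounded_continuous (g i).
  split; first exact: cg.
  exists 1; split; first exact: real1.
  by move=> M M1 z _ /=; rewrite ger0_norm// (le_trans (g1 i z))// ltW.
have IE nu : ((I nu)%:E = \int[nu]_(z in [set: borel R k]) (g i z)%:E)%E.
  rewrite fineK// ge0_fin_numE; last by apply: integral_ge0 => z _; rewrite lee_fin.
  apply: (@le_lt_trans _ _ (\int[nu]_(z in [set: borel R k]) (cst 1 z)))%E.
    apply: ge0_le_integral => //.
    - by move=> z _; rewrite lee_fin.
    - exact/measurable_EFinP.
    - by move=> z _; rewrite lee_fin.
  rewrite integral_cst// mul1e.
  exact: le_lt_trans (probability_le1 nu measurableT) (ltry 1).
exists (e / 3 / i.+1%:R); first by rewrite !divr_gt0.
have : \forall nu \near mu, `|I mu - I nu| < e / 3.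
  have e3 : 0 < e / 3 by rewrite divr_gt0.
  have cI : I @ nbhs mu --> I mu by exact: (integral_continuous bcg).
  by move/cvgrPdist_lt : cI => /(_ _ e3).
apply: filterS => nu muI a' aa'.
have muFI : (mu (F i) <= (I mu)%:E)%E.
  rewrite IE -[F i]setIT -integral_indic//; apply: ge0_le_integral => //.
  - by apply/measurable_EFinP; exact: measurable_indic.
  - exact/measurable_EFinP.
  - move=> z _; rewrite lee_fin indicE; case: (boolP (z \in _)) => [/set_mem <-//|_].
    exact: g0.
have InuS : ((I nu)%:E <= nu [set z : 'cV[R]_k | D (a' + z)%R] + (e / 3)%:E)%E.
  set S' : set (borel R k) := [set z : 'cV[R]_k | D (a' + z)].
  have mS' : measurable S' by exact: mshift.
  have -> : (nu S' + (e / 3)%:E =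
      \int[nu]_(z in [set: borel R k]) ((\1_S' z)%:E + (cst (e / 3)%:E z)))%E.
    rewrite ge0_integralD//.
    - rewrite integral_indic// setIT integral_cst//; congr (_ + _)%E.
      rewrite -[LHS]mule1; congr (_ * _)%E.
      exact/esym/probability_setT.
    - by apply/measurable_EFinP; exact: measurable_indic.
    - by move=> z _; rewrite lee_fin ltW// divr_gt0.
  rewrite IE; apply: ge0_le_integral => //.
  - by move=> z _; rewrite lee_fin.
  - exact/measurable_EFinP.
  - apply: emeasurable_funD => //.
    by apply/measurable_EFinP; exact: measurable_indic.
  move=> z _; rewrite -EFinD lee_fin indicE.
  case: (boolP (z \in _)) => [_|/negP zS'].
    by rewrite (le_trans (g1 i z))// lerDl ltW// divr_gt0.
  rewrite add0r; apply: (le_trans (lipschitz_bump_lip D i _ (a' + z))).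
  have : lipschitz_bump D i (a' + z) <= 0.
    by apply: lipschitz_bump_out => Dz; apply: zS'; exact/mem_set.
  have -> : a + z - (a' + z) = a - a' by rewrite opprD addrACA subrr addr0.
  by move: aa'; rewrite distrC ler_pdivlMr// mulrC; lra.
move: muF muFI InuS; rewrite -/S muS.
have [f -> _] := prob_real mu (mF i).
have [n -> _] := prob_real nu (mshift a').
rewrite -!EFinD !lee_fin; move: muI => /ltr_normlP[].
lra.
Qed.

End support.

(** * Random variables with finitely many values *)

Section finitely_valued.
Context {R : realType} {d : measure_display} {T : measurableType d}.
Variable P : probability T R.

(** The cells need not cover the whole space, only have total probability one.
    The cells included in [S] bound its probability from below, the others do
    the same for the complement of [S]. *)
Lemma prob_partition (N : nat) (E : nat -> set T) (w : nat -> R)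
    (J : pred nat) (S : set T) :
  (forall i, measurable (E i)) -> trivIset setT E ->
  (forall i, (i < N)%N -> P (E i) = (w i)%:E) -> \sum_(i < N) w i = 1 ->
  measurable S ->
  (forall i t, (i < N)%N -> E i t -> S t <-> J i) ->
  P S = (\sum_(i < N | J i) w i)%:E.
Proof.
move=> mE tE PE w1 mS SJ.
have sub_ge (K : pred nat) (U : set T) : measurable U ->
    (forall i t, (i < N)%N -> K i -> E i t -> U t) ->
    ((\sum_(i < N | K i) w i)%:E <= P U)%E.
  move=> mU KU; pose EK i := if K i then E i else set0.
  have mEK i : measurable (EK i) by rewrite /EK; case: ifP.
  rewrite big_mkcond/=.
  rewrite -(@prob_bigsetU _ _ _ P N EK (fun i => if K i then w i else 0))//.
  - apply: le_prob => //; first exact: bigsetU_measurable.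
    rewrite -bigcup_mkord => t [i /= iN]; rewrite /EK.
    by case: ifP => // Ki Eit; exact: KU Eit.
  - apply/trivIsetP => i j _ _ ij; rewrite /EK.
    case: ifP => _; last by rewrite set0I.
    case: ifP => _; last by rewrite setI0.
    by move/trivIsetP : tE; exact.
  - by move=> i iN; rewrite /EK; case: ifP => // _; rewrite ?PE// measure0.
apply/eqP; rewrite eq_le; apply/andP; split; last first.
  by apply: (sub_ge J) => // i t iN Ji Eit; exact/(SJ i t).
have : ((\sum_(i < N | ~~ J i) w i)%:E <= P (~` S))%E.
  apply: (sub_ge (fun i => ~~ J i)) => [|i t iN Ji Eit]; first exact: measurableC.
  by move=> St; apply/negP: Ji; rewrite negbK; exact/(SJ i t).
have : \sum_(i < N) w i = \sum_(i < N | J i) w i + \sum_(i < N | ~~ J i) w i.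
  exact: bigID.
rewrite w1 probability_setC//; have [a -> _] := prob_real P mS.
by rewrite -EFinB !lee_fin; lra.
Qed.

Definition simple_rv (N : nat) (a : nat -> R) (E : nat -> set T) (t : T) : R :=
  \sum_(i < N) a i * \1_(E i) t.

Lemma simple_rv_on N a E i t : trivIset setT E -> (i < N)%N -> E i t ->
  simple_rv N a E t = a i.
Proof.
move=> tE iN Eit; rewrite /simple_rv (bigD1 (Ordinal iN))//= big1 ?addr0.
  by rewrite indicE mem_set// mulr1.
move=> j /eqP ji; rewrite indicE memNset ?mulr0// => Ejt.
have /trivIsetP /(_ i j I I) := tE; case: (eqVneq i j) => [ij _|_ /(_ isT)].
  by apply: ji; exact/val_inj.
by move/seteqP => [/(_ t) + _]; apply.
Qed.

Lemma simple_rv_le N a E t : `|simple_rv N a E t| <= \sum_(i < N) `|a i|.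
Proof.
apply: (le_trans (ler_norm_sum _ _ _)); apply: ler_sum => i _.
by rewrite normrM indicE; case: (_ \in _); rewrite ?normr1 ?mulr1// normr0 mulr0.
Qed.

Lemma measurable_simple_rv N a E : (forall i, measurable (E i)) ->
  measurable_fun setT (simple_rv N a E).
Proof.
move=> mE; apply: measurable_sum => i; apply: measurable_funM => //.
Qed.

Lemma Lfun_bounded (p K : R) (f : T -> R) : 1 <= p -> measurable_fun setT f ->
  (forall t, `|f t| <= K) -> f \in Lfun P p%:E.
Proof.
move=> p1 mf fK; apply/andP; split; rewrite inE//= /finite_norm unlock poweR_lty//.
apply: (@le_lt_trans _ _ (\int[P]_t cst (K `^ p)%:E t)%E).
  apply: ge0_le_integral => //.
  - by move=> t _; exact: poweR_ge0.
  - apply/measurable_EFinP; apply: (measurableT_comp (measurable_powR _)).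
    exact: measurableT_comp.
  - move=> t _ /=; rewrite lee_fin ge0_ler_powR ?nnegrE//.
      by rewrite (le_trans ler01).
    exact: le_trans (fK t).
rewrite integral_cst// lte_mul_pinfty ?lee_fin ?powR_ge0//.
exact: le_lt_trans (probability_le1 P measurableT) (ltry 1).
Qed.

Lemma simple_rv_Lfun (p : R) N a E : 1 <= p -> (forall i, measurable (E i)) ->
  simple_rv N a E \in Lfun P p%:E.
Proof.
move=> p1 mE; apply: Lfun_bounded p1 _ (simple_rv_le N a E).
exact: measurable_simple_rv.
Qed.

End finitely_valued.

(** A set that only depends on the membership of its points in finitely many
    measurable sets is a union of atoms of the algebra that they generate. In
    the induction, each half of [E] (inside and outside [L i]) is first
    saturated so that it no longer depends on [L i]. *)
Lemma measurable_atoms (I : eqType) d (T : measurableType d) (L : I -> set T)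
    (s : seq I) (E : set T) :
  (forall i, measurable (L i)) ->
  (forall t t', (forall i, i \in s -> L i t <-> L i t') -> E t -> E t') ->
  measurable E.
Proof.
move=> mL; elim: s E => [|i s IH] E invE.
  have [[t0 Et0]|/set0P/negP/negPn/eqP ->//] := pselect (E !=set0).
  suff -> : E = setT by [].
  by apply/seteqP; split => // t _; exact: invE Et0.
pose half (A : set T) := [set t | exists2 t', (E `&` A) t' &
  forall j, j \in s -> L j t' <-> L j t].
have mhalf A : measurable (half A).
  apply: IH => t t' tt' [u EAu ut]; exists u => // j js.
  by rewrite ut//; exact: tt'.
have -> : E = (half (L i) `&` L i) `|` (half (~` L i) `&` ~` L i).
  apply/seteqP; split => [t Et|t [[[u [Eu Lu] ut] Lt]|[[u [Eu Lu] ut] Lt]]].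
  - have [Lt|Lt] := pselect (L i t).
    + by left; split => //; exists t.
    + by right; split => //; exists t.
  - apply: invE Eu => j; rewrite inE => /orP[/eqP ->//|]; exact: ut.
  - apply: invE Eu => j; rewrite inE => /orP[/eqP ->//|]; exact: ut.
by apply: measurableU; apply: measurableI => //; exact: measurableC.
Qed.

Lemma seq_argmin (R : realType) (I : eqType) (f : I -> R) (s : seq I) : s != [::] ->
  exists2 x, x \in s & forall y, y \in s -> f x <= f y.
Proof.
elim: s => // a [|b s] IH _.
  by exists a; rewrite ?inE// => y; rewrite inE => /eqP ->.
have [//|x xs xmin] := IH; have [ax|xa] := leP (f a) (f x).
  exists a; rewrite ?inE ?eqxx// => y; rewrite inE => /orP[/eqP->//|/xmin].
  exact: le_trans.
exists x; first by rewrite inE xs orbT.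
by move=> y; rewrite inE => /orP[/eqP->|/xmin//]; exact: ltW.
Qed.

(** * The value function of the lower level problem *)

Section value_function.
Context {R : realType} {n m s : nat}.
Variables (c : 'cV[R]_n) (T : 'M[R]_(s, n)) (W : 'M[R]_(s, m)).
Variables (q d : 'cV[R]_m) (Y : set 'cV[R]_m).
Hypothesis finY : finite_set (int_points Y).
Local Notation phi := (phi W q d Y).

Lemma phi_values : exists2 V : seq R, uniq V &
  forall t, phi t = +oo%E \/ exists2 v, v \in V & phi t = v%:E.
Proof.
have /finite_seqP[ys ysE] := finY.
exists (undup [seq dotv q y | y <- ys]) => [|t]; first exact: undup_uniq.
have Psi_ys y : Psi W d Y t y -> y \in ys.
  by move=> [[_ Yy] _]; have : [set` ys] y by rewrite -ysE.
pose opt := [seq y <- ys | `[<Psi W d Y t y>]].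
have optE y : y \in opt <-> Psi W d Y t y.
  rewrite mem_filter; split => [/andP[/asboolP//]|Py].
  by rewrite Psi_ys// andbT; exact/asboolP.
have [opt0|/(seq_argmin (dotv q))[y /optE Py ymin]] := eqVneq opt [::].
  left; rewrite /Defs.phi [X in ereal_inf X](_ : _ = set0) ?ereal_inf0//.
  by apply/seteqP; split => // r [y /optE + _]; rewrite opt0.
right; exists (dotv q y); first by rewrite mem_undup map_f// Psi_ys.
apply/eqP; rewrite eq_le; apply/andP; split.
  by apply: ereal_inf_lbound; exists y.
by apply: le_ereal_inf_tmp => _ [y' /optE oy' <-]; rewrite lee_fin ymin.
Qed.

(** The value of [phi] at a point only depends on which of the finitely many
    integer points are feasible there. *)
Lemma measurable_phi_level (v : \bar R) :
  measurable [set w : borel R n * borel R s |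
    phi (T *m (w.1 : 'cV[R]_n) + (w.2 : 'cV[R]_s)) = v].
Proof.
have /finite_seqP[ys ysE] := finY.
pose L (y : 'cV[R]_m) := [set w : borel R n * borel R s |
  lev (W *m y) (T *m (w.1 : 'cV[R]_n) + (w.2 : 'cV[R]_s))].
have mL y : measurable (L y).
  have -> : L y = \bigcap_(i in [set: 'I_s]) [set w : borel R n * borel R s |
      (cst ((W *m y) i ord0) w <= (T *m (w.1 : 'cV[R]_n)) i ord0
        + (w.2 : 'cV[R]_s) i ord0)%R].
    apply/seteqP; split => w.
      by move=> Lw i _ /=; have := Lw i; rewrite [in X in _ <= X]mxE.
    by move=> h i; have := h i I; rewrite /= [in X in _ -> _ <= X]mxE.
  apply: fin_bigcap_measurable => // i _; rewrite -[X in measurable X]setTI.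
  apply: measurable_fun_le => //; apply: measurable_funD.
    have mTi : measurable_fun [set: borel R n]
        (fun u : borel R n => (T *m (u : 'cV[R]_n)) i ord0).
      apply: borel_continuous.
      apply: (@lipschitz_continuous _ _ _ (\sum_i \sum_j `|T i j|)) => u u'.
      apply: le_trans (mulmx_lip T u u').
      by have := entry_le_norm (T *m u - T *m u') i ord0; rewrite !mxE.
    exact: measurableT_comp mTi measurable_fst.
  have mi : measurable_fun [set: borel R s]
      (fun u : borel R s => (u : 'cV[R]_s) i ord0).
    by apply: borel_continuous; exact: coord_continuous.
  exact: measurableT_comp mi measurable_snd.
apply: (measurable_atoms (s := ys) mL) => w w' ww' /= <-.
have feas : feasible W Y (T *m w'.1 + w'.2) = feasible W Y (T *m w.1 + w.2).
  apply/seteqP; split => y [Wy Yy]; split => //.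
    by apply/(ww' y) => //; have : [set` ys] y by rewrite -ysE.
  by apply/(ww' y) => //; have : [set` ys] y by rewrite -ysE.
by rewrite /Defs.phi /Psi feas.
Qed.

(** The finite values of [phi] are isolated, so that continuity means local
    constancy. *)
Lemma phi_locally_constant (t0 : 'cV[R]_s) (v : R) :
  {for t0, continuous phi} -> phi t0 = v%:E ->
  nbhs t0 [set t | phi t = v%:E].
Proof.
move=> cphi phi0; have [V _ phiV] := phi_values.
have : phi @ nbhs t0 --> v%:E by rewrite -phi0; exact: cphi.
move=> /(fine_cvgP (FF := nbhs_filter t0))[phifin /cvgrPdist_lt phiv].
have : \forall t \near t0, forall i : 'I_(size V),
    V`_i != v -> `|v - fine (phi t)| < `|v - V`_i|.
  apply: (filter_forall (F := nbhs t0)) => i; have [->|Vv] := eqVneq V`_i v.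
    by apply: nearW => t.
  have Vv0 : 0 < `|v - V`_i| by rewrite normr_gt0 subr_eq0 eq_sym.
  by apply: filterS (phiv _ Vv0) => t.
apply: filterS2 phifin => t phit farV /=.
have [phioo|[u uV phitu]] := phiV t; first by rewrite phioo in phit.
rewrite phitu; congr EFin; apply/eqP/negPn/negP => uv.
have iu : (index u V < size V)%N by rewrite index_mem.
have := farV (Ordinal iu); rewrite /= nth_index// phitu/= ltxx.
by move=> /(_ uv).
Qed.

End value_function.

(** * The law of the objective and the risk *)

Section value_cells.
Context {R : realType} {n m s : nat}.
Variables (c : 'cV[R]_n) (T : 'M[R]_(s, n)) (W : 'M[R]_(s, m)).
Variables (q d : 'cV[R]_m) (Y : set 'cV[R]_m).
Hypothesis finY : finite_set (int_points Y).
Local Notation phi := (phi W q d Y).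

Variable V : seq R.
Hypothesis V_uniq : uniq V.
Hypothesis phiV : forall t, phi t = +oo%E \/ exists2 v, v \in V & phi t = v%:E.

(** The bound on [i] empties the cells beyond the list of values; without it
    they would be those of the default value 0 of [V`_i]. *)
Definition value_cell (x : 'cV[R]_n) (i : nat) : set (borel R s) :=
  [set z | (i < size V)%N /\ phi (T *m x + (z : 'cV[R]_s)) = (V`_i)%:E].

Lemma measurable_value_cell x i : measurable (value_cell x i).
Proof.
have [iV|iV] := ltnP i (size V); last first.
  rewrite (_ : value_cell x i = set0)//; apply/seteqP; split => // z [].
  by rewrite ltnNge iV.
have := measurable_xsection (x : borel R n) (measurable_phi_level T W q d finY (V`_i)%:E).
rewrite xsectionE; congr measurable; apply/seteqP; split => z //=.
by case.
Qed.

Lemma trivIset_value_cell x : trivIset setT (value_cell x).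
Proof.
apply/trivIsetP => i j _ _ ij; apply/seteqP; split => // z [[iV Vi] [jV]].
by rewrite Vi => -[/eqP]; rewrite nth_uniq// (negbTE ij).
Qed.

Lemma measurable_objective_preimage (B : set R) : measurable B ->
  measurable (objective c T W q d Y @^-1` (EFin @` B) :
    set (borel R n * borel R s)).
Proof.
move=> mB.
have -> : objective c T W q d Y @^-1` (EFin @` B) =
    \bigcup_(v in [set` V]) ([set w : borel R n * borel R s |
       phi (T *m (w.1 : 'cV[R]_n) + (w.2 : 'cV[R]_s)) = v%:E] `&`
     [set w | B (dotv c (w.1 : 'cV[R]_n) + v)]).
  apply/seteqP; split => [[x z] [b Bb]|[x z] [v _ [/= phiv Bv]]].
    rewrite /objective/=.
    have [->//|[v vV phiv]] := phiV (T *m x + z).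
    rewrite phiv => -[bE]; exists v => //; split => //=.
    by rewrite -bE.
  by exists (dotv c x + v) => //; rewrite /objective/= phiv.
apply: fin_bigcup_measurable => [|v _]; first exact: finite_seq.
apply: measurableI; first exact: measurable_phi_level.
have mc : measurable_fun [set: borel R n]
    (fun u : borel R n => dotv c (u : 'cV[R]_n)).
  apply: borel_continuous.
  apply: (@lipschitz_continuous _ _ _ (\sum_i `|c i ord0|)) => u u'.
  exact: dotv_lip.
have mcv : measurable_fun [set: borel R n * borel R s]
    (fun w : borel R n * borel R s => dotv c (w.1 : 'cV[R]_n) + v).
  apply: measurable_funD => //; exact: measurableT_comp mc measurable_fst.
by have := mcv measurableT B mB; rewrite setTI.
Qed.

Lemma objective_lawE (x : 'cV[R]_n) (nu : probability (borel R s) R)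
    (B : set R) : measurable B ->
  objective_law c T W q d Y x nu B =
  nu (xsection (objective c T W q d Y @^-1` (EFin @` B) :
    set (borel R n * borel R s)) x).
Proof.
move=> /measurable_objective_preimage mA.
rewrite /objective_law /product_measure1 integral_dirac//.
  by rewrite diracT mul1e.
exact: measurable_fun_xsection.
Qed.

Definition value_weight (x : 'cV[R]_n) (nu : probability (borel R s) R)
  (i : nat) : R := fine (nu (value_cell x i)).

Lemma value_weightE x (nu : probability (borel R s) R) i :
  nu (value_cell x i) = (value_weight x nu i)%:E.
Proof.
have [a nua _] := prob_real nu (measurable_value_cell x i).
by rewrite /value_weight nua.
Qed.

Lemma value_weight_ge0 x (nu : probability (borel R s) R) i :
  0 <= value_weight x nu i.
Proof. by rewrite fine_ge0. Qed.

Variable X : set 'cV[R]_n.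

(** For an admissible measure the cells contain the support, which has full
    measure. *)
Lemma sum_value_weight x (nu : probability (borel R s) R) :
  X x -> admissible_measures c T W q d Y X nu ->
  \sum_(i < size V) value_weight x nu i = 1.
Proof.
move=> Xx adm.
have mU : measurable (\big[setU/set0]_(i < size V) value_cell x i).
  by apply: bigsetU_measurable => i _; exact: measurable_value_cell.
have nuU := @prob_bigsetU _ _ _ nu (size V) (value_cell x) (value_weight x nu)
  (measurable_value_cell x) (@trivIset_value_cell x)
  (fun i _ => value_weightE x nu i).
apply: EFin_inj; rewrite -nuU; apply/eqP; rewrite eq_le probability_le1//=.
rewrite -(supp_full nu); apply: le_prob => //.
  by apply: borel_closed; exact: closed_supp.
move=> z suppz; rewrite -bigcup_mkord.
have : objective c T W q d Y (x, z) \is a fin_num by exact: (adm (x, z)).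
rewrite /objective/=; have [->//|[v vV phiv] _] := phiV (T *m x + z).
have iV : (index v V < size V)%N by rewrite index_mem.
by exists (index v V) => //; split => //; rewrite nth_index.
Qed.

Lemma objective_law_weights x (nu : probability (borel R s) R) (B : set R) :
  X x -> admissible_measures c T W q d Y X nu -> measurable B ->
  objective_law c T W q d Y x nu B =
  (\sum_(i < size V | `[< B (dotv c x + V`_i) >]) value_weight x nu i)%:E.
Proof.
move=> Xx adm mB; rewrite objective_lawE//.
apply: (@prob_partition _ _ _ nu (size V) (value_cell x) (value_weight x nu)
  (fun i => `[< B (dotv c x + V`_i) >])).
- exact: measurable_value_cell.
- exact: trivIset_value_cell.
- by move=> i _; exact: value_weightE.
- exact: sum_value_weight.
- by apply: (measurable_xsection (x : borel R n)); exact: measurable_objective_preimage.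
- move=> i z iV [_ phiz]; rewrite xsectionE /= /objective/= phiz; split.
    by move=> [b Bb [bE]]; apply/asboolP; rewrite -bE.
  by move=> /asboolP Bv; eexists; [exact: Bv|].
Qed.

Section risk_value.
Context {dO : measure_display} {Omega : measurableType dO}.
Variable P : probability Omega R.
Context {p : R} {p1 : (1 <= p%:E)%E}.
Variable rho : LfunType P p1 -> R.
Hypothesis rho_law : law_invariant rho.

(** By law invariance the risk can be computed from any random variable that
    takes the right values on events of the right probabilities. In particular
    the random variable [Z] shows that the law of the objective is attained,
    so that the choice made in [Q_risk] is not the default one. *)
Lemma Q_riskE x (nu : probability (borel R s) R) (E : nat -> set Omega)
    (Z : LfunType P p1) :
  X x -> admissible_measures c T W q d Y X nu ->
  (forall i, measurable (E i)) -> trivIset setT E ->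
  (forall i, (i < size V)%N -> P (E i) = (value_weight x nu i)%:E) ->
  (forall i t, (i < size V)%N -> E i t -> Z t = dotv c x + V`_i) ->
  Q_risk rho c T W q d Y (x, nu) = rho Z.
Proof.
move=> Xx adm mE tE PE ZE.
have lawZ : (has_objective_law c T W q d Y x nu : set (LfunType P p1)) Z.
  move=> B mB; rewrite (objective_law_weights Xx adm mB).
  apply: (@prob_partition _ _ _ P (size V) E (value_weight x nu)
    (fun i => `[< B (dotv c x + V`_i) >])) => //.
  - exact: sum_value_weight.
  - by rewrite -[X in measurable X]setTI; exact: measurable_funPT.
  - by move=> i t iV Eit; rewrite /= (ZE i t iV Eit); split => /asboolP.
apply: rho_law => B mB; rewrite lawZ//.
by have := @xgetPex _ 0 _ (ex_intro _ Z lawZ); exact.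
Qed.

End risk_value.

End value_cells.

(** * Continuity of the risk *)

Section value_weight_lsc.
Context {R : realType} {n m s : nat}.
Variables (T : 'M[R]_(s, n)) (W : 'M[R]_(s, m)).
Variables (q d : 'cV[R]_m) (Y : set 'cV[R]_m).
Hypothesis finY : finite_set (int_points Y).
Local Notation phi := (phi W q d Y).

(** Up to a null set of discontinuities, the [i]-th cell at [x] consists of the
    [z] such that [T *m x + z] lies in the interior [D] of a level set of
    [phi]; the portmanteau inequality then applies to [D]. *)
Lemma value_weight_lsc (V : seq R) (x : 'cV[R]_n) (mu : probability (borel R s) R)
    (i : nat) (e : R) : 0 < e ->
  mu.-negligible
    [set z : borel R s | ~ {for T *m x + z, continuous phi}] ->
  nbhs (x, mu) [set w : 'cV[R]_n * probability (borel R s) R |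
    value_weight T W q d Y V x mu i <= value_weight T W q d Y V w.1 w.2 i + e].
Proof.
move=> e0 negl.
have [iV|iV] := ltnP i (size V); last first.
  have cell0 x' : value_cell T W q d Y V x' i = set0.
    by apply/seteqP; split => // z []; rewrite ltnNge iV.
  apply: filterE => -[x' nu] /=.
  by rewrite /value_weight !cell0 !measure0/= add0r ltW.
pose D := [set t | phi t = (V`_i)%:E]°.
have oD : open D by exact: open_interior.
have Dphi : D `<=` [set t | phi t = (V`_i)%:E] by exact: interior_subset.
have [dl dl0 near_mu] := portmanteau_shift mu (T *m x) oD e0.
pose K := \sum_i \sum_j `|T i j|.
have K0 : 0 <= K by apply: sumr_ge0 => ? _; exact: sumr_ge0.
have near_x : nbhs x [set x' | `|T *m x' - T *m x| <= dl].
  apply/nbhs_ballP; exists (dl / (K + 1)) => /=; first by rewrite divr_gt0// ltr_wpDl.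
  move=> x'; rewrite -ball_normE/= ltr_pdivlMr ?ltr_wpDl// => xx'.
  rewrite distrC; apply: le_trans (mulmx_lip T x x') _.
  by apply: le_trans (ltW xx'); rewrite mulrC ler_wpM2l// lerDl.
exists ([set x' | `|T *m x' - T *m x| <= dl], [set nu : probability (borel R s) R |
    forall a' : 'cV[R]_s, `|a' - T *m x| <= dl ->
    (mu [set z : 'cV[R]_s | D (T *m x + z)%R] <=
     nu [set z : 'cV[R]_s | D (a' + z)%R] + e%:E)%E]) => //.
move=> [x' nu] [/= xx' /(_ _ xx') munu].
have mcell y := measurable_value_cell T W q d finY V y i.
rewrite -lee_fin EFinD -!value_weightE//.
have [N [mN muN0 Nsub]] := negl.
have mD y := borel_open (open_shift (b := T *m y) oD).
apply: (@le_trans _ _ (mu [set z : 'cV[R]_s | D (T *m x + z)])).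
  rewrite -(measureU0 (mD x) mN muN0); apply: le_prob => //.
    exact: measurableU.
  move=> z [_ phiz]; have [cphi|ncphi] := pselect {for T *m x + z, continuous phi}.
    by left; exact: (phi_locally_constant finY cphi phiz).
  by right; exact: Nsub.
apply: le_trans munu _; apply: leeD => //; apply: le_prob => // z Dz.
by split => //; exact: Dphi Dz.
Qed.

End value_weight_lsc.
Theorem theorem5p1 (R : realType) (n m s : nat)
  (X : set 'cV[R]_n) (c : 'cV[R]_n)
  (T : 'M[R]_(s, n)) (W : 'M[R]_(s, m))
  (q d : 'cV[R]_m) (Y : set 'cV[R]_m)
  (p : R) (p1 : (1 <= p%:E)%E)
  (dO : measure_display) (Omega : measurableType dO) (P : probability Omega R)
  (rho : LfunType P p1 -> R)
  (M : set (probability (borel R s) R))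
  (x : 'cV[R]_n) (mu : probability (borel R s) R) :
  polyhedron X -> X !=set0 ->
  int_points Y !=set0 -> finite_set (int_points Y) ->
  atomless P ->
  convex_function [set: convex_lmodType (LfunType P p1)] rho ->
  nondecreasing_risk rho -> law_invariant rho ->
  M `<=` admissible_measures c T W q d Y X ->
  locally_uniformly_integrating p M ->
  X x -> M mu ->
  mu.-negligible
    [set z : borel R s | ~ {for T *m x + z, continuous (phi W q d Y)}] ->
  Q_risk rho c T W q d Y @ within (X `*` M) (nbhs (x, mu)) -->
    Q_risk rho c T W q d Y (x, mu).
Proof.
move=> _ _ _ finY atomlessP rho_convex rho_mono rho_law Madm _ Xx Mmu negl.
have [V V_uniq phiV] := phi_values W q d finY.
pose N := size V.
pose wt y (nu : probability (borel R s) R) := value_weight T W q d Y V y nu.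
have pge1 : 1 <= p by rewrite -lee_fin.
have sum_wt y (nu : probability (borel R s) R) : X y -> M nu ->
    \sum_(i < N) wt y nu i = 1.
  by move=> Xy /Madm; exact: sum_value_weight.
have wt0 y nu i : 0 <= wt y nu i by exact: value_weight_ge0.
have QE y (nu : probability (borel R s) R) (E : nat -> set Omega)
    (mE : forall i, measurable (E i)) : X y -> M nu -> trivIset setT E ->
    (forall i, (i < N)%N -> P (E i) = (wt y nu i)%:E) ->
    Q_risk rho c T W q d Y (y, nu) =
    rho (Lfun_Sub p1 (simple_rv_Lfun P N (fun i => dotv c y + V`_i) pge1 mE)).
  move=> Xy /Madm Mnu tE PE; apply: (Q_riskE finY V_uniq phiV rho_law Xy Mnu mE tE PE).
  by move=> i t iN Et /=; exact: simple_rv_on.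
have [||B [mB _ tB PB B0]] := @partition_weights _ _ _ P atomlessP N (wt x mu) setT measurableT.
- exact: wt0.
- by rewrite sum_wt// probability_setT.
pose a i := dotv c x + V`_i.
pose Z := Lfun_Sub p1 (simple_rv_Lfun P N a pge1 mB).
apply/cvgrPdist_le => e e0.
rewrite (QE x mu B mB)// -/Z.
pose K := \sum_(i < N) `|a i|.
have K0 : 0 <= K by exact: sumr_ge0.
(* K bounds Z; since c.x' differs from c.x by at most 1, K + N bounds Z'. *)
have [|dl dl0 rho_dl] := @risk_continuity _ _ _ P p p1 rho rho_convex rho_mono Z
  (K + K + N%:R) e _ e0.
  by rewrite !addr_ge0.
(* N+1 instead of N allows for an empty list of values. *)
pose eta := dl / N.+1%:R.
have eta0 : 0 < eta by rewrite divr_gt0.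
have near_wt : nbhs (x, mu) [set w : 'cV[R]_n * probability (borel R s) R |
    forall i : 'I_N, wt x mu i <= wt w.1 w.2 i + eta].
  apply: (filter_forall (F := nbhs (x, mu))) => i.
  exact: value_weight_lsc.
have near_c : nbhs (x, mu) [set w : 'cV[R]_n * probability (borel R s) R |
    `|dotv c x - dotv c w.1| <= Num.min dl 1].
  exists ([set x' | `|dotv c x - dotv c x'| <= Num.min dl 1], setT); last by case=> ? ? [].
  split; last exact: filterT.
  pose L := \sum_i `|c i ord0|.
  have L0 : 0 <= L by exact: sumr_ge0.
  apply/nbhs_ballP; exists (Num.min dl 1 / (L + 1)) => /=.
    by rewrite divr_gt0 ?ltr_wpDl// lt_min dl0/=.
  move=> x'; rewrite -ball_normE/= ltr_pdivlMr ?ltr_wpDl// => xx'.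
  apply: le_trans (dotv_lip c x x') _.
  by apply: le_trans (ltW xx'); rewrite mulrC ler_wpM2l// lerDl.
rewrite /within/=; apply: filterS2 near_wt near_c => -[x' nu]/= wt_le c_le [Xx' Mnu].
have [B' [D [[mB' tB' PB' B'0] mD PD offD]]] := @coupling_partition _ _ _ P atomlessP N B
  (wt x mu) (wt x' nu) mB tB PB B0 (sum_wt _ _ Xx Mmu) (wt0 _ _) (sum_wt _ _ Xx' Mnu).
rewrite (QE x' nu B' mB')// distrC.
apply: (rho_dl _ D mD).
  rewrite PD lee_fin; apply: (@le_trans _ _ (\sum_(i < N) eta)).
    by apply: ler_sum => i _; have := wt_le i; rewrite minEle; case: ifP; lra.
  rewrite sumr_const card_ord -mulr_natr /eta -mulrA ler_piMr ?ltW//.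
  by rewrite ltr_pdivrMl// mulr1 ltr_nat.
move: c_le; rewrite le_min => /andP[c_dl c_1] t; rewrite indicE.
case: (boolP (t \in D)) => [_|/negP tD]; last first.
  have [|i iN [Bit B'it]] := offD t; first by move=> Dt; apply: tD; exact/mem_set.
  rewrite mulr0 addr0 /= (simple_rv_on _ tB' iN B'it) (simple_rv_on _ tB iN Bit) /a.
  by rewrite opprD addrACA subrr addr0 distrC.
(* On D, only the bounds on both random variables are used. *)
rewrite mulr1; apply: (le_trans (ler_normB _ _)) => /=.
have h1 := simple_rv_le N (fun i => dotv c x' + V`_i) B' t.
have h2 := simple_rv_le N a B t.
have h3 : \sum_(i < N) `|dotv c x' + V`_i| <= K + N%:R.
  rewrite /K -[N in N%:R]card_ord -sumr_const -big_split/=; apply: ler_sum => i _.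
  have := ler_normD (dotv c x' - dotv c x) (a i); rewrite distrC /a.
  have -> : dotv c x' - dotv c x + (dotv c x + V`_i) = dotv c x' + V`_i by ring.
  lra.
by move: h2; rewrite -/K; lra.
Qed.
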